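(* A permutation $\pi$ contains the boxed pattern $\mathrm{Box}(2413)$ if and only if $\pi$ contains the vincular pattern $2\underline{41}3$.
   Context: $\mathfrak S_n$ is the set of permutations $\pi=\pi_1\cdots\pi_n$ of $[n]=\{1,\dots,n\}$. For $\tau\in\mathfrak S_k$, an occurrence of the boxed pattern $\mathrm{Box}(\tau)$ in $\pi\in\mathfrak S_n$ is a choice of positions $i_1<\cdots<i_k$ such that $\pi_{i_1}\cdots\pi_{i_k}$ is order-isomorphic to $\tau$ and there is no index $j\notin\{i_1,\dots,i_k\}$ with $i_1<j<i_k$ and $\min_r \pi_{i_r}<\pi_j<\max_r\pi_{i_r}$. An occurrence of the vincular pattern $2\underline{41}3$ in $\pi$ is a subsequence $a,b,c,d$ of $\pi$ (in this positional order) such that $b$ and $c$ are in adjacent positions of $\pi$ ($c$ immediately after $b$) and $c<a<d<b$. A permutation contains a pattern if it has at least one occurrence of it. *)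

(* Defs.v *)
From mathcomp Require Import all_boot all_fingroup.

Set Implicit Arguments.
Unset Strict Implicit.
Unset Printing Implicit Defensive.

(* Positions and values are numbered from 0, so a permutation of [n] in
   one-line notation is pi 0, ..., pi (n - 1) with pi : 'S_n. *)

(* i 0 < ... < i (k - 1) are the positions of a subsequence of pi that is
   order-isomorphic to tau. *)
Definition pattern_occ n k (tau : 'S_k) (pi : 'S_n) (i : 'I_k -> 'I_n) : Prop :=
  (forall r s : 'I_k, r < s -> i r < i s) /\
  (forall r s : 'I_k, (pi (i r) < pi (i s)) = (tau r < tau s)).

(* Patterns are nonempty (length k.+1), so that the first and last positions
   and the extreme values exist. The default n of the minimum is never
   attained, since all values are < n. *)
Definition box_occ n k (tau : 'S_k.+1) (pi : 'S_n) (i : 'I_k.+1 -> 'I_n) : Prop :=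
  pattern_occ tau pi i /\
  ~ (exists j : 'I_n,
       [/\ forall r, j <> i r,
           i ord0 < j < i ord_max
         & \big[minn/n]_r (pi (i r) : nat) < pi j < \max_r (pi (i r) : nat)]).

Definition contains_box n k (tau : 'S_k.+1) (pi : 'S_n) : Prop :=
  exists i : 'I_k.+1 -> 'I_n, box_occ tau pi i.

(* 2413 shifted down by one, as values start at 0. *)
Definition word2413 (i : 'I_4) : 'I_4 := inord (nth 0 [:: 1; 3; 0; 2] i).

Lemma word2413_inj : injective word2413.
Proof.
move=> [[|[|[|[|x]]]] hx] // [[|[|[|[|y]]]] hy] // /(congr1 val);
  rewrite /= !inordK //= => _; exact: val_inj.
Qed.

Definition perm2413 : 'S_4 := perm word2413_inj.

(* a, b, c, d are the positions, not the values, of the four entries. *)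
Definition vinc2413_occ n (pi : 'S_n) (a b c d : 'I_n) : Prop :=
  [/\ a < b, c = b.+1 :> nat, c < d & [&& pi c < pi a, pi a < pi d & pi d < pi b]].

Definition contains_vinc2413 n (pi : 'S_n) : Prop :=
  exists a b c d : 'I_n, vinc2413_occ pi a b c d.

(* Main.v *)
Require Import Defs.
From mathcomp Require Import all_boot all_fingroup.
From mathcomp Require Import zify.

(** Write A, B, C, D for the values of a 2413 at positions a < b < c < d, so
    that C < A < D < B.

    In a boxed occurrence every entry between b and c is at least B or at most
    C.  Reading from b to c, the sequence passes from the high entries to the
    low ones, so the last high entry before c is immediately followed by a low
    one.  These two entries can replace b and c, and are adjacent
    ([vinc2413_of_boxed]).

    Conversely, keep the adjacent positions b and c of a vincular occurrence,
    and choose a and d with d - a minimal.  An entry between a and b with value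
    in (C, D) could replace a, and an entry between c and d with value in (A, B)
    could replace d; so there are none ([vinc2413_shortest]), and as b and c are
    adjacent there is nothing between them either.  Hence an entry that still
    lies in the box is either above D and left of b, or below A and
    right of c.  Lowering the 4 to the least entry above D on the left, and
    raising the 1 to the greatest entry below A on the right, empties the box
    ([boxed_of_vinc2413]). *)

(** [contains_box perm2413] in terms of four positions ([contains_box2413P]):
    the extreme values of a 2413 are those of its second and third entries, and
    the strict inequalities already exclude the four entries from the box. *)
Definition boxed2413 {n} (pi : 'S_n) (a b c d : 'I_n) : Prop :=
  [/\ a < b, b < c, c < d,
      [&& pi c < pi a, pi a < pi d & pi d < pi b]
    & forall j : 'I_n, a < j < d -> ~~ (pi c < pi j < pi b)].

Lemma big_ord4 (F : 'I_4 -> nat) (op : nat -> nat -> nat) (idx : nat) :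
  \big[op/idx]_r F r =
  op (F (inord 0)) (op (F (inord 1)) (op (F (inord 2)) (op (F (inord 3)) idx))).
Proof.
rewrite !big_ord_recl big_ord0.
by congr (op (F _) (op (F _) (op (F _) (op (F _) _))));
  apply: val_inj; rewrite /= inordK.
Qed.

Lemma forall_ord4 (P : 'I_4 -> Prop) :
  P (inord 0) -> P (inord 1) -> P (inord 2) -> P (inord 3) -> forall r, P r.
Proof.
move=> P0 P1 P2 P3 r; rewrite -(inord_val r).
by case: r => [[|[|[|[|r]]]] hr].
Qed.

Lemma perm2413E k : k < 4 -> perm2413 (inord k) = nth 0 [:: 1; 3; 0; 2] k :> nat.
Proof.
move=> lt_k4; rewrite permE /word2413 inordK // inordK //.
by case: k lt_k4 => [|[|[|[|k]]]].
Qed.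

Lemma contains_box2413P {n} (pi : 'S_n) :
  contains_box perm2413 pi <-> exists a b c d, boxed2413 pi a b c d.
Proof.
have ord0E : ord0 = inord 0 :> 'I_4 by apply: val_inj; rewrite /= inordK.
have ord_maxE : ord_max = inord 3 :> 'I_4 by apply: val_inj; rewrite /= inordK.
split=> [[i [[pos_i val_i] box_i]] | [a [b [c [d]]]] [ab bc cd vals box]].
- exists (i (inord 0)), (i (inord 1)), (i (inord 2)), (i (inord 3)).
  have lt01 : i (inord 0) < i (inord 1) by apply: pos_i; rewrite !inordK.
  have lt12 : i (inord 1) < i (inord 2) by apply: pos_i; rewrite !inordK.
  have lt23 : i (inord 2) < i (inord 3) by apply: pos_i; rewrite !inordK.
  have ca : pi (i (inord 2)) < pi (i (inord 0)) by rewrite val_i !perm2413E.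
  have ad : pi (i (inord 0)) < pi (i (inord 3)) by rewrite val_i !perm2413E.
  have db : pi (i (inord 3)) < pi (i (inord 1)) by rewrite val_i !perm2413E.
  split=> //; first by rewrite ca ad db.
  move=> j pos_j; apply/negP => val_j; apply: box_i; exists j; split.
  + by apply: forall_ord4 => eq_j; subst j; lia.
  + by rewrite ord0E ord_maxE.
  + by rewrite !big_ord4; have := ltn_ord (pi (i (inord 2))); lia.
- pose i (r : 'I_4) := nth a [:: a; b; c; d] r.
  have i0 : i (inord 0) = a by rewrite /i inordK.
  have i1 : i (inord 1) = b by rewrite /i inordK.
  have i2 : i (inord 2) = c by rewrite /i inordK.
  have i3 : i (inord 3) = d by rewrite /i inordK.
  exists i; split; first split.
  + by do 2!apply: forall_ord4; rewrite ?i0 ?i1 ?i2 ?i3 !inordK //; lia.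
  + by do 2!apply: forall_ord4; rewrite ?i0 ?i1 ?i2 ?i3 !perm2413E //=; lia.
  + case=> j [_]; rewrite ord0E ord_maxE i0 i3 => pos_j.
    rewrite !big_ord4 i0 i1 i2 i3 => val_j.
    (* so that the default n of the minimum is not the least value *)
    have lt_cn := ltn_ord (pi c).
    by move/negP: (box j pos_j); apply; lia.
Qed.

Lemma vinc2413_of_boxed {n} (pi : 'S_n) (a b c d : 'I_n) :
  boxed2413 pi a b c d -> contains_vinc2413 pi.
Proof.
case=> ab bc cd vals box.
have high_b : [&& b <= b, b < c & pi b <= pi b] by rewrite !leqnn bc.
(* the last entry before c that is at least B *)
case: (arg_maxnP (fun x : 'I_n => nat_of_ord x)
         (P := fun x : 'I_n => [&& b <= x, x < c & pi b <= pi x]) high_b).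
move=> b' /and3P[bb' b'c high_b'] last_b'.
have lt_c'n : b'.+1 < n by exact: leq_ltn_trans b'c (ltn_ord c).
pose c' := Ordinal lt_c'n.
have low_c' : pi c' <= pi c.
  case: (eqVneq c' c) => [-> // | ne_c'c].
  have lt_c'c : c' < c by rewrite ltn_neqAle ne_c'c.
  have not_high : pi c' < pi b.
    rewrite ltnNge; apply/negP => high_c'.
    by have := last_b' c'; rewrite /= high_c' lt_c'c; lia.
  by have := box c'; rewrite not_high /= in lt_c'c *; lia.
by exists a, b', c', d; split=> //=; lia.
Qed.

(** Moving an outer entry inwards, with b and c fixed, preserves adjacency, so
    a choice that minimizes the distance between the outer entries leaves no
    candidate for such a move. *)
Lemma vinc2413_shortest {n} (pi : 'S_n) (a b c d : 'I_n) :
  vinc2413_occ pi a b c d ->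
  exists a' d', [/\ vinc2413_occ pi a' b c d',
    forall j : 'I_n, a' < j < b -> ~~ (pi c < pi j < pi d')
  & forall j : 'I_n, c < j < d' -> ~~ (pi a' < pi j < pi b)].
Proof.
case=> ab bc cd vals.
pose outer (p : 'I_n * 'I_n) :=
  [&& p.1 < b, c < p.2, pi c < pi p.1, pi p.1 < pi p.2 & pi p.2 < pi b].
have outer_ad : outer (a, d) by rewrite /outer /= ab cd.
case: (arg_minnP (fun p : 'I_n * 'I_n => p.2 - p.1) outer_ad).
move=> [a' d'] /and5P[/= a'b cd' ca' a'd' d'b] shortest.
exists a', d'; split; first by split=> //; apply/and3P.
- move=> j pos_j; apply/negP => val_j.
  by have := shortest (j, d'); rewrite /outer /=; lia.
- move=> j pos_j; apply/negP => val_j.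
  by have := shortest (a', j); rewrite /outer /=; lia.
Qed.

Lemma boxed_of_vinc2413 {n} (pi : 'S_n) (a b c d : 'I_n) :
  vinc2413_occ pi a b c d -> exists a' b' c' d', boxed2413 pi a' b' c' d'.
Proof.
case/vinc2413_shortest=> {}a [{}d [[ab bc cd vals] no_a no_d]].
have b_ok : [&& a < b, b <= b & pi d < pi b] by lia.
have c_ok : [&& c <= c, c < d & pi c < pi a] by lia.
case: (arg_minnP (fun x => nat_of_ord (pi x))
         (P := fun x : 'I_n => [&& a < x, x <= b & pi d < pi x]) b_ok).
move=> b' /and3P[ab' b'b db'] least_b'.
case: (arg_maxnP (fun x => nat_of_ord (pi x))
         (P := fun x : 'I_n => [&& c <= x, x < d & pi x < pi a]) c_ok).
move=> c' /and3P[cc' c'd c'a] greatest_c'.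
exists a, b', c', d; split=> //; try lia.
move=> j pos_j; apply/negP => val_j.
have least_j := least_b' j; have greatest_j := greatest_c' j.
have := least_b' b b_ok; have := greatest_c' c c_ok => /= Cc' Bb'.
have [jb | bj] := leqP j b.
- (* j is at most D, since it is below the least entry above D; it is not D
     itself, as it sits at another position *)
  have ne_jd : pi j != pi d :> nat.
    by apply/eqP => /val_inj/perm_inj eq_jd; subst j; lia.
  have ne_jb : nat_of_ord j != b.
    by apply/eqP => /val_inj eq_jb; subst j; lia.
  by have := no_a j; lia.
- (* the mirror image: reversing and complementing fixes 2413 *)
  have ne_ja : pi j != pi a :> nat.
    by apply/eqP => /val_inj/perm_inj eq_ja; subst j; lia.
  have ne_jc : nat_of_ord j != c.
    by apply/eqP => /val_inj eq_jc; subst j; lia.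
  by have := no_d j; lia.
Qed.

Theorem lemma4p1 (n : nat) (pi : 'S_n) :
  contains_box perm2413 pi <-> contains_vinc2413 pi.
Proof.
rewrite contains_box2413P; split=> [[a [b [c [d]]]] | [a [b [c [d]]]]].
- exact: vinc2413_of_boxed.
- exact: boxed_of_vinc2413.
Qed.
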